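(* Let $V=\mathbb{C}[G]\otimes\mathbb{C}[x_1,x_2,\dots]$, where $G$ is the free abelian group with basis $\alpha_1,\dots,\alpha_k$, with the Hopf structure in which the $e^{\alpha}$ ($\alpha\in G$) are grouplike and the $x_m$ are primitive. Let $A$ be a commutative $\mathbb{C}$-algebra and $r$ an $A$-valued bicharacter on $V$ taking complex values on grouplike elements, with $r(e^{\alpha_i}\otimes e^{\alpha_j})=e^{a_{ij}}$ ($a_{ij}\in\mathbb{C}$), $r(e^{\alpha_i}\otimes x_m)=b_{im}$, $r(x_m\otimes e^{\alpha_i})=c_{mi}$, $r(x_m\otimes x_n)=q_{mn}$. Let $s=r\circ r^t$ be its symmetrization and $\bullet=\bullet_s$. Let \[ \mathbf{Q}=\sum_{i,j=1}^{k}a_{ij}\frac{\partial}{\partial\alpha_i}\frac{\partial}{\partial\alpha_j}+\sum_{i=1}^{k}\sum_{m\ge1}b_{im}\frac{\partial}{\partial\alpha_i}\frac{\partial}{\partial x_m}+\sum_{m\ge1}\sum_{i=1}^{k}c_{mi}\frac{\partial}{\partial x_m}\frac{\partial}{\partial\alpha_i}+\sum_{m,n\ge1}q_{mn}\frac{\partial^2}{\partial x_m\partial x_n}. \] Then for every $a\in V$, \[ e^{\mathbf{Q}}(a)=\mathrm{EQ}_r(a)=\sum r(a'\otimes a'')a''', \] moreover $e^{\mathbf{Q}}(a)=a^{\bullet}$, and $e^{\mathbf{Q}}$ is a homomorphism from $(V\otimes A,\cdot)$ to $(V\otimes A,\bullet)$.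
   Context: Hopf structure: $\Delta(e^{\alpha})=e^\alpha\otimes e^\alpha$, $\eta(e^\alpha)=1$; $\Delta(x_m)=x_m\otimes1+1\otimes x_m$, $\eta(x_m)=0$. Sweedler notation: $\Delta(a)=\sum a'\otimes a''$, $\Delta^2(a)=\sum a'\otimes a''\otimes a'''$. An $A$-valued bicharacter is a linear map $r:V\otimes V\to A$ with $r(1\otimes a)=\eta(a)=r(a\otimes1)$, $r(ab\otimes c)=\sum r(a\otimes c')r(b\otimes c'')$, $r(a\otimes bc)=\sum r(a'\otimes b)r(a''\otimes c)$. Convolution $(r\circ t)(a\otimes b)=\sum r(a'\otimes b')t(a''\otimes b'')$, $r^t(a\otimes b)=r(b\otimes a)$. The product $\bullet_s$ on $V\otimes A$ is the $A$-bilinear extension of $a\bullet_s b=\sum a'b'\,s(a''\otimes b'')$ (associative, commutative). Derivations: $\frac{\partial}{\partial\alpha_i}(e^{\alpha}P(x))=m_ie^\alpha P(x)$ for $\alpha=\sum m_j\alpha_j$; $\frac{\partial}{\partial x_m}$ acts on the polynomial factor. $e^{\mathbf{Q}}$ is the product of the commuting exponentials of the four summands, the first acting on $e^\alpha P$ as multiplication by $\exp(\sum a_{ij}m_im_j)$, the others as locally finite power series. For $P\in\mathbb{C}[x_1,x_2,\dots]$, $P^\bullet$ is obtained by replacing each monomial $x_{i_1}\cdots x_{i_n}$ in $P$ by $x_{i_1}\bullet\cdots\bullet x_{i_n}$. For $a=e^{\alpha}P$ one sets $a^\bullet=(e^\alpha)^\bullet\bullet P^\bullet$ with $(e^\alpha)^\bullet=e^{\alpha}r(e^\alpha\otimes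 e^\alpha)$, extended linearly to all of $V$. *)

(* Defs.v *)
From mathcomp Require Import all_boot all_order all_algebra.
From mathcomp Require Import reals.
From mathcomp.analysis Require Import sequences exp trigo.
From mathcomp Require Import complex.

Set Implicit Arguments.
Unset Strict Implicit.
Unset Printing Implicit Defensive.

Import GRing.Theory Num.Theory.
Local Open Scope ring_scope.

Definition cexp (R : realType) (z : R[i]) : R[i] :=
  let: Complex x y := z in Complex (expR x * cos y) (expR x * sin y).

(* The basis of V = C[G] (x) C[x_1, x_2, ...].
   G = Z^k is represented by {ffun 'I_k -> int} (alpha = sum_i m_i alpha_i
   is the function i |-> m_i).
   A basis element e^alpha x_{n_1+1} x_{n_2+1} ... x_{n_l+1} is the pair
   (alpha, [:: n_1; ...; n_l]); the list entry n stands for the variable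
   x_{n+1} (index shift, so that variables are x_1, x_2, ...).  Two lists
   that are permutations of each other denote the same monomial. *)
Definition grp (k : nat) := {ffun 'I_k -> int}.
Definition basis (k : nat) := (grp k * seq nat)%type.

Section Defs.
Variable k : nat.

Definition bone : basis k := (0, [::]).
Definition bmul (a b : basis k) : basis k := (a.1 + b.1, a.2 ++ b.2).
Definition bgen (i : 'I_k) : basis k := ([ffun j => (i == j)%:Z], [::]).
Definition bx (n : nat) : basis k := (0, [:: n]).

(* Elements of V (x) T, T = C or A: formal finite T-linear combinations of
   basis elements, represented by lists of (coefficient, basis element);
   two lists represent the same element iff all coefficients agree. *)
Definition fsum (T : Type) := seq (T * basis k).

Definition coef (T : nmodType) (X : fsum T) (b : basis k) : T :=
  \sum_(t <- X | (t.2.1 == b.1) && perm_eq t.2.2 b.2) t.1.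

Definition fs_eq (T : nmodType) (X Y : fsum T) : Prop :=
  forall b, coef X b = coef Y b.

(* Coproduct: e^alpha grouplike, x_m primitive, so
   Delta(e^alpha x_{n1}...x_{nl}) = sum_{S subset [1..l]} e^alpha x_S (x) e^alpha x_{S^c}
   (unreduced Sweedler sum, indexed by masks). *)
Definition bits (n : nat) : seq bitseq := [seq val t | t <- enum {: n.-tuple bool}].

Definition cop (b : basis k) : seq (basis k * basis k) :=
  [seq ((b.1, mask m b.2), (b.1, mask (map negb m) b.2)) | m <- bits (size b.2)].

Definition cop2 (b : basis k) : seq (basis k * basis k * basis k) :=
  flatten [seq [seq (p.1, q.1, q.2) | q <- cop p.2] | p <- cop b].

Variable R : realType.
Local Notation C := R[i].
Variable A : comAlgType C.

Definition counit (b : basis k) : A := if b.2 is [::] then 1 else 0.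

(* A-valued bicharacter on V: a C-linear map V (x) V -> A, given by its values
   on pairs of basis elements (well defined on monomials), satisfying the
   bicharacter axioms (checked on basis elements, which suffices by linearity). *)
Definition bicharacter (r : basis k -> basis k -> A) : Prop :=
  [/\ (forall a a' b b', a.1 = a'.1 -> perm_eq a.2 a'.2 ->
          b.1 = b'.1 -> perm_eq b.2 b'.2 -> r a b = r a' b'),
      (forall a, r bone a = counit a /\ r a bone = counit a),
      (forall a b c, r (bmul a b) c = \sum_(p <- cop c) r a p.1 * r b p.2) &
      (forall a b c, r a (bmul b c) = \sum_(p <- cop a) r p.1 b * r p.2 c)].

Definition conv (r t : basis k -> basis k -> A) (a b : basis k) : A :=
  \sum_(p <- cop a) \sum_(p' <- cop b) r p.1 p'.1 * t p.2 p'.2.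
Definition transp (r : basis k -> basis k -> A) (a b : basis k) : A := r b a.
Definition symz (r : basis k -> basis k -> A) := conv r (transp r).

Definition emb (X : fsum C) : fsum A := [seq (t.1%:A, t.2) | t <- X].
Definition scl (c : A) (X : fsum A) : fsum A := [seq (c * t.1, t.2) | t <- X].
Definition ext (f : basis k -> fsum A) (X : fsum A) : fsum A :=
  flatten [seq scl t.1 (f t.2) | t <- X].
Definition ext2 (f : basis k -> basis k -> fsum A) (X Y : fsum A) : fsum A :=
  flatten [seq scl (x.1 * y.1) (f x.2 y.2) | x <- X, y <- Y].
Definition fone : fsum A := [:: (1, bone)].

Definition fmul (X Y : fsum A) : fsum A := ext2 (fun a b => [:: (1, bmul a b)]) X Y.

Definition bulletB (s : basis k -> basis k -> A) (a b : basis k) : fsum A :=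
  [seq (s p.2 p'.2, bmul p.1 p'.1) | p <- cop a, p' <- cop b].
Definition bullet (s : basis k -> basis k -> A) := ext2 (bulletB s).

Definition EQ (r : basis k -> basis k -> A) : fsum A -> fsum A :=
  ext (fun b => [seq (r t.1.1 t.1.2, t.2) | t <- cop2 b]).

Definition Pdot (s : basis k -> basis k -> A) (mu : seq nat) : fsum A :=
  foldr (fun n acc => bullet s [:: (1, bx n)] acc) fone mu.
Definition edot (r : basis k -> basis k -> A) (al : grp k) : fsum A :=
  [:: (r (al, [::]) (al, [::]), (al, [::]))].
Definition dot (r : basis k -> basis k -> A) : fsum A -> fsum A :=
  ext (fun b => bullet (symz r) (edot r b.1) (Pdot (symz r) b.2)).

Definition dalpha (i : 'I_k) : fsum A -> fsum A :=
  ext (fun b => [:: ((b.1 i)%:~R, b)]).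
Definition dx (n : nat) : fsum A -> fsum A :=
  ext (fun b => [:: ((count_mem n b.2)%:R, (b.1, rem n b.2))]).

(* variables occurring in X (other variables' derivatives kill X, so the
   infinite sums over m in Q reduce to sums over these) *)
Definition vars (X : fsum A) : seq nat := undup (flatten [seq t.2.2 | t <- X]).
Definition xdeg (X : fsum A) : nat := (\max_(t <- X) size t.2.2)%N.

(* the summands 2,3,4 of Q  (b i n = b_{i,n+1}, c n i = c_{n+1,i}, q m n = q_{m+1,n+1}) *)
Definition Q2 (b : 'I_k -> nat -> A) (X : fsum A) : fsum A :=
  flatten [seq scl (b i n) (dalpha i (dx n X)) | i <- enum 'I_k, n <- vars X].
Definition Q3 (c : nat -> 'I_k -> A) (X : fsum A) : fsum A :=
  flatten [seq scl (c n i) (dx n (dalpha i X)) | n <- vars X, i <- enum 'I_k].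
Definition Q4 (q : nat -> nat -> A) (X : fsum A) : fsum A :=
  flatten [seq scl (q m n) (dx m (dx n X)) | m <- vars X, n <- vars X].

(* exponential of a locally nilpotent operator lowering the x-degree:
   exp(D) X = sum_{n <= deg X} D^n X / n!  (all further terms vanish) *)
Definition lfexp (D : fsum A -> fsum A) (X : fsum A) : fsum A :=
  flatten [seq scl ((n`!%:R : C)^-1)%:A (iter n D X) | n <- iota 0 (xdeg X).+1].

(* exponential of the first summand: multiplication of e^alpha P by
   exp(sum_{i,j} a_ij m_i m_j) *)
Definition E1 (a : 'I_k -> 'I_k -> C) : fsum A -> fsum A :=
  ext (fun b => [:: ((cexp (\sum_(i < k) \sum_(j < k) a i j * (b.1 i * b.1 j)%:~R))%:A, b)]).

(* e^Q : product of the four commuting exponentials *)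
Definition expQ a b c q (X : fsum A) : fsum A :=
  lfexp (Q4 q) (lfexp (Q3 c) (lfexp (Q2 b) (E1 a X))).

End Defs.

(* Main.v *)
Require Import Defs.
From mathcomp Require Import all_boot all_order all_algebra.
From mathcomp Require Import reals boolp ring.
From mathcomp.analysis Require Import sequences exp trigo.
From mathcomp Require Import complex.
Import GRing.Theory Num.Theory.
Local Open Scope ring_scope.

(* Elements of V (x) A are tested against functions [phi] on monomials that do
   not depend on the order of the variables, so that every linear operator is
   replaced by its transpose on such functions.

   The commutator of Q with multiplication by x_n is
   D_n = sum_i (b_{in} + c_{ni}) d/d alpha_i + sum_m (q_{mn} + q_{nm}) d/d x_m,
   and x_n + D_n is exactly left bullet-multiplication by x_n, whence
   e^Q (x_n P) = x_n bullet e^Q (P).  On the other hand the bicharacter axioms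
   and cocommutativity alone give EQ_r (ab) = EQ_r (a) bullet EQ_r (b), and
   EQ_r (x_n) = x_n.  Both operators thus obey the same recursion on monomials,
   and they agree on e^alpha since r (e^alpha, e^alpha) is the Gaussian factor.
   Multiplicativity of EQ_r also yields EQ_r (a) = a^bullet, factor by factor. *)

Set Implicit Arguments.
Unset Strict Implicit.
Unset Printing Implicit Defensive.

(** The product [bmul (bx k n) b] with its group part already reduced to [b.1]; the inductions on
    monomials build them in this form. *)
Definition xcons k (n : nat) (b : basis k) : basis k := (b.1, n :: b.2).

(** * Coproduct identities, tested against arbitrary functions of the legs *)

Section Coproduct.
Variables (k : nat) (T : nmodType).
Implicit Types (a b : basis k) (F : basis k -> basis k -> T).

(** The order in which [enum] lists tuples does not matter: both sides are duplicate-free with the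
    same members. The first bit decides which leg of the coproduct receives the head variable. *)
Lemma perm_bits_cons n :
  perm_eq (bits n.+1) (map (cons true) (bits n) ++ map (cons false) (bits n)).
Proof.
have bitsP m (s : bitseq) : (s \in bits m) = (size s == m).
  apply/mapP/eqP=> [[t _ ->]|sz_s]; first exact: size_tuple.
  by exists (Tuple (introT eqP sz_s)); rewrite ?mem_enum.
have bits_uniq m : uniq (bits m).
  by rewrite map_inj_uniq ?enum_uniq //; apply: val_inj.
have cons_inj x : injective (cons x : bitseq -> bitseq) by move=> s t [].
apply: uniq_perm => //.
  rewrite cat_uniq !(map_inj_uniq (cons_inj _)) !bits_uniq andbT /=.
  by apply/hasPn=> s /mapP[t _ ->]; apply/mapP=> -[].
have notin x s t : ohead s != Some x -> (s \in map (cons x) t) = false.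
  by move=> s_x; apply/mapP=> -[u _ s_xu]; rewrite s_xu eqxx in s_x.
case=> [|[] s]; rewrite mem_cat bitsP ?(mem_map (cons_inj _)) !notin //.
  by rewrite orbF bitsP.
by rewrite bitsP.
Qed.

Lemma sum_cop_nil al F :
  \sum_(p <- cop (al, [::])) F p.1 p.2 = F (al, [::]) (al, [::]).
Proof.
rewrite /cop /= big_map /bits big_map.
rewrite (eq_bigr (fun=> F (al, [::]) (al, [::]))) => [|t _]; last first.
  by rewrite (tuple0 t).
by rewrite big_const_seq count_predT -cardE card_tuple expn0 /= addr0.
Qed.

(** Primitivity of [x_n]. Together with the grouplike case [sum_cop_nil] it drives the inductions
    below. *)
Lemma sum_cop_xcons n a F :
  \sum_(p <- cop (xcons n a)) F p.1 p.2 =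
  \sum_(p <- cop a) F (xcons n p.1) p.2 + \sum_(p <- cop a) F p.1 (xcons n p.2).
Proof.
case: a => al mu; have copE (nu : seq nat) (G : basis k -> basis k -> T) :
    \sum_(p <- cop (al, nu)) G p.1 p.2 =
    \sum_(m <- bits (size nu)) G (al, mask m nu) (al, mask (map negb m) nu) by exact: big_map.
rewrite (copE (n :: mu)) (copE mu (fun u v => F (xcons n u) v)).
rewrite (copE mu (fun u v => F u (xcons n v))).
rewrite (perm_big _ (perm_bits_cons _)) big_cat /=.
by congr (_ + _); apply: big_map.
Qed.

Lemma sum_cop_bmul a b F :
  \sum_(p <- cop (bmul a b)) F p.1 p.2 =
  \sum_(p <- cop a) \sum_(p' <- cop b) F (bmul p.1 p'.1) (bmul p.2 p'.2).
Proof.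
case: a b => [al mu] [be nu]; elim: mu F => [|n mu IH] F.
  rewrite (sum_cop_nil al (fun u v => \sum_(p' <- cop (be, nu)) F (bmul u p'.1) (bmul v p'.2))).
  by rewrite /bmul /= /cop !big_map.
rewrite -[bmul _ _]/(xcons n (al + be, mu ++ nu)) sum_cop_xcons.
rewrite -[(_, mu ++ nu)]/(bmul (al, mu) (be, nu)).
rewrite (IH (fun u v => F (xcons n u) v)) (IH (fun u v => F u (xcons n v))).
by rewrite (sum_cop_xcons n (al, mu) (fun u v =>
  \sum_(p' <- cop (be, nu)) F (bmul u p'.1) (bmul v p'.2))).
Qed.

Lemma sum_copC a F :
  \sum_(p <- cop a) F p.1 p.2 = \sum_(p <- cop a) F p.2 p.1.
Proof.
case: a => al mu; elim: mu F => [|n mu IH] F.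
  by rewrite sum_cop_nil (sum_cop_nil al (fun u v => F v u)).
rewrite (sum_cop_xcons n (al, mu)) (sum_cop_xcons n (al, mu) (fun u v => F v u)) addrC.
by rewrite (IH (fun u v => F (xcons n u) v)) (IH (fun u v => F u (xcons n v))).
Qed.

Lemma sum_copA a (F : basis k -> basis k -> basis k -> T) :
  \sum_(p <- cop a) \sum_(p' <- cop p.1) F p'.1 p'.2 p.2 =
  \sum_(p <- cop a) \sum_(p' <- cop p.2) F p.1 p'.1 p'.2.
Proof.
case: a => al mu; elim: mu F => [|n mu IH] F.
  rewrite (sum_cop_nil al (fun u v => \sum_(p' <- cop u) F p'.1 p'.2 v)).
  rewrite (sum_cop_nil al (fun u v => \sum_(p' <- cop v) F u p'.1 p'.2)).
  by rewrite (sum_cop_nil al (fun u v => F u v _)) (sum_cop_nil al (F _)).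
rewrite (sum_cop_xcons n (al, mu) (fun u v => \sum_(p' <- cop u) F p'.1 p'.2 v)).
rewrite (sum_cop_xcons n (al, mu) (fun u v => \sum_(p' <- cop v) F u p'.1 p'.2)).
under eq_bigr=> p _ do rewrite (sum_cop_xcons _ _ (fun u v => F u v _)).
under [X in _ = _ + X]eq_bigr=> p _ do rewrite (sum_cop_xcons _ _ (F _)).
rewrite !big_split /= (IH (fun u v w => F (xcons n u) v w)).
rewrite (IH (fun u v w => F u (xcons n v) w)) (IH (fun u v w => F u v (xcons n w))).
by rewrite addrA.
Qed.

(** Coassociativity rebrackets so that the two middle legs form the coproduct of one element;
    cocommutativity then swaps them. *)
Lemma sum_cop_interchange a (F : basis k -> basis k -> basis k -> basis k -> T) :
  \sum_(p <- cop a) \sum_(u <- cop p.1) \sum_(v <- cop p.2) F u.1 u.2 v.1 v.2 =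
  \sum_(p <- cop a) \sum_(u <- cop p.1) \sum_(v <- cop p.2) F u.1 v.1 u.2 v.2.
Proof.
have flat (G : basis k -> basis k -> basis k -> basis k -> T) :
    \sum_(p <- cop a) \sum_(u <- cop p.1) \sum_(v <- cop p.2) G u.1 u.2 v.1 v.2 =
    \sum_(p <- cop a) \sum_(u <- cop p.2) \sum_(v <- cop u.1) G p.1 v.1 v.2 u.2.
  rewrite (sum_copA a (fun x y z => \sum_(v <- cop z) G x y v.1 v.2)).
  apply: eq_bigr => p _; apply/esym.
  exact: (sum_copA p.2 (fun x y z => G p.1 x y z)).
rewrite flat (flat (fun x y z w => F x z y w)).
apply: eq_bigr => p _; apply: eq_bigr => u _.
exact: (sum_copC u.1 (fun x y => F p.1 x y u.2)).
Qed.

(** The left bracketing arises from [EQ] of a product once the bicharacter axioms split both slots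
    of [r]. The right one lists the Gaussian legs, then the output, then the two cross legs, as in a
    bullet product of Gaussians. *)
Lemma sum_cop5 a (F : basis k -> basis k -> basis k -> basis k -> basis k -> T) :
  \sum_(x <- cop a) \sum_(y <- cop x.1) \sum_(z <- cop x.2) \sum_(t <- cop z.1)
    F y.1 y.2 t.1 t.2 z.2 =
  \sum_(x <- cop a) \sum_(y <- cop x.2) \sum_(z <- cop y.2) \sum_(t <- cop z.2)
    F x.1 t.1 y.1 t.2 z.1.
Proof.
under eq_bigr=> x _ do rewrite exchange_big.
rewrite -(sum_copA a (fun u v w =>
  \sum_(y <- cop u) \sum_(t <- cop v) F y.1 y.2 t.1 t.2 w)).
under eq_bigr=> x _ do rewrite (sum_cop_interchange x.1 (fun u v w z => F u v w z x.2)).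
rewrite (sum_copA a (fun u v w =>
  \sum_(y <- cop u) \sum_(t <- cop v) F y.1 t.1 y.2 t.2 w)).
under eq_bigr=> x _.
  rewrite (sum_copC x.2 (fun u v => \sum_(y <- cop x.1) \sum_(t <- cop u) F y.1 t.1 y.2 t.2 v)).
  rewrite exchange_big.
  over.
exact: (sum_copA a (fun u v w => \sum_(z <- cop w) \sum_(t <- cop z.2) F u t.1 v t.2 z.1)).
Qed.

Definition perm_inv (f : basis k -> T) : Prop :=
  forall al mu nu, perm_eq mu nu -> f (al, mu) = f (al, nu).

Lemma perm_inv_sum_cop F :
  (forall v, perm_inv (F^~ v)) -> (forall u, perm_inv (F u)) ->
  perm_inv (fun a => \sum_(p <- cop a) F p.1 p.2).
Proof.
move=> Fl Fr al mu nu mu_nu.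
pose S nu := \sum_(p <- cop (al, nu)) F p.1 p.2.
suff: S mu = S nu by [].
(* It suffices to exchange the two leading blocks; multiplicativity of the coproduct turns this into
   the same exchange inside each leg. *)
apply: (catCA_perm_ind (P := fun nu => S mu = S nu)) mu_nu (erefl _) => s1 s2 s3 ->.
have splitE (u v w : seq nat) :
    (al, u ++ v ++ w) = bmul (0, u) (bmul (0, v) (al, w)) :> basis k.
  by rewrite /bmul /= !add0r.
rewrite /S !splitE !sum_cop_bmul; under eq_bigr=> p _ do
  rewrite (sum_cop_bmul _ _ (fun u v => F (bmul p.1 u) (bmul p.2 v))).
under [RHS]eq_bigr=> p _ do
  rewrite (sum_cop_bmul _ _ (fun u v => F (bmul p.1 u) (bmul p.2 v))).
rewrite exchange_big; apply: eq_bigr => u _; apply: eq_bigr => v _; apply: eq_bigr => w _.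
have bmulCA (x y z : basis k) f : perm_inv f -> f (bmul x (bmul y z)) = f (bmul y (bmul x z)).
  move=> f_inv; rewrite /bmul /= (addrCA x.1).
  exact: f_inv (permEl (perm_catCA _ _ _)).
by rewrite (bmulCA _ _ _ (F^~ _)) // bmulCA.
Qed.

End Coproduct.

(** * Evaluation of formal sums on test functions *)

Section Evaluation.
Variables (R : realType) (k : nat) (A : comAlgType R[i]).
Local Notation C := R[i].
Implicit Types (X Y : fsum k A) (phi psi : basis k -> A) (r s : basis k -> basis k -> A).

Definition ev phi X : A := \sum_(t <- X) t.1 * phi t.2.

(** Quantifying over all order-independent test functions lets the relation pass through any
    operator whose transpose preserves such functions. *)
Definition fs_equiv X Y : Prop := forall phi, perm_inv phi -> ev phi X = ev phi Y.

(** A coefficient is the evaluation at the indicator of a monomial, and that indicator ignores the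
    order of the variables. *)
Lemma fs_equivW X Y : fs_equiv X Y -> fs_eq X Y.
Proof.
move=> XY b.
pose ind (c : basis k) : A := ((c.1 == b.1) && perm_eq c.2 b.2)%:R.
have coefE Z : coef Z b = ev ind Z.
  rewrite /coef /ev big_mkcond; apply: eq_bigr => t _; rewrite /ind.
  by case: ifP; rewrite ?mulr1 ?mulr0.
rewrite !coefE; apply: XY => al mu nu /permPl mu_nu.
by rewrite /ind /= mu_nu.
Qed.

Lemma ev_seq1 phi (c : A) b : ev phi [:: (c, b)] = c * phi b.
Proof. exact: big_seq1. Qed.

Lemma ev_cat phi X Y : ev phi (X ++ Y) = ev phi X + ev phi Y.
Proof. exact: big_cat. Qed.

Lemma ev_scl phi (c : A) X : ev phi (scl c X) = c * ev phi X.
Proof.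
by rewrite /ev /scl big_map mulr_sumr; apply: eq_bigr => t _; rewrite /= mulrA.
Qed.

Lemma ev_flatten phi (I : Type) (s : seq I) (F : I -> fsum k A) :
  ev phi (flatten [seq F i | i <- s]) = \sum_(i <- s) ev phi (F i).
Proof. by rewrite /ev big_flatten big_map. Qed.

Lemma ev_allpairs phi (I J : Type) (s : seq I) (t : seq J) (F : I -> J -> fsum k A) :
  ev phi (flatten [seq F i j | i <- s, j <- t]) =
  \sum_(i <- s) \sum_(j <- t) ev phi (F i j).
Proof. by rewrite /ev big_flatten big_allpairs_dep. Qed.

Lemma eq_ev phi psi X : phi =1 psi -> ev phi X = ev psi X.
Proof. by move=> eq_phi; apply: eq_bigr => t _; rewrite eq_phi. Qed.

Lemma ev_ext phi f X : ev phi (ext f X) = ev (fun b => ev phi (f b)) X.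
Proof. by rewrite ev_flatten; apply: eq_bigr => t _; rewrite ev_scl. Qed.

Lemma ev_ext2 phi f X Y :
  ev phi (ext2 f X Y) = ev (fun x => ev (fun y => ev phi (f x y)) Y) X.
Proof.
rewrite ev_allpairs; apply: eq_bigr => x _.
rewrite /ev mulr_sumr; apply: eq_bigr => y _.
by rewrite [LHS]ev_scl mulrA.
Qed.

Lemma ev_exchange (F : basis k -> basis k -> A) X Y :
  ev (fun x => ev (F x) Y) X = ev (fun y => ev (F^~ y) X) Y.
Proof.
rewrite /ev; under eq_bigr=> x _ do rewrite mulr_sumr.
rewrite exchange_big; apply: eq_bigr => y _; rewrite mulr_sumr.
by apply: eq_bigr => x _; rewrite mulrCA.
Qed.

Lemma ev_fmul phi X Y :
  ev phi (fmul X Y) = ev (fun x => ev (fun y => phi (bmul x y)) Y) X.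
Proof.
rewrite ev_ext2; apply: eq_ev => x; apply: eq_ev => y.
by rewrite ev_seq1 mul1r.
Qed.

Lemma ev_bulletB phi s a b :
  ev phi (bulletB s a b) =
  \sum_(p <- cop a) \sum_(p' <- cop b) s p.2 p'.2 * phi (bmul p.1 p'.1).
Proof. by rewrite /ev big_allpairs_dep. Qed.

Definition EQB r (b : basis k) : fsum k A :=
  [seq (r t.1.1 t.1.2, t.2) | t <- cop2 b].

Lemma ev_EQ phi r X : ev phi (EQ r X) = ev (fun b => ev phi (EQB r b)) X.
Proof. exact: ev_ext. Qed.

Lemma ev_EQB phi r b :
  ev phi (EQB r b) =
  \sum_(p <- cop b) \sum_(p' <- cop p.2) r p.1 p'.1 * phi p'.2.
Proof.
rewrite /ev /EQB /cop2 big_map big_flatten big_map.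
by apply: eq_bigr => p _; rewrite big_map.
Qed.

Lemma sum_cop_counitl a phi : \sum_(p <- cop a) counit A p.1 * phi p.2 = phi a.
Proof.
case: a => al mu; elim: mu phi => [|n mu IH] phi.
  by rewrite (sum_cop_nil al (fun u v => counit A u * phi v)) mul1r.
rewrite (sum_cop_xcons n (al, mu) (fun u v => counit A u * phi v)).
rewrite (IH (fun v => phi (xcons n v))) big1 ?add0r // => p _.
by rewrite /counit mul0r.
Qed.

Lemma sum_cop_counitr a phi : \sum_(p <- cop a) phi p.1 * counit A p.2 = phi a.
Proof.
rewrite -[RHS]sum_cop_counitl (sum_copC a (fun u v => phi u * counit A v)).
by apply: eq_bigr => p _; rewrite mulrC.
Qed.

(** * Multiplicativity of the Gaussian operator *)

Section Bicharacter.
Variable r : basis k -> basis k -> A.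
Hypothesis r_bichar : bicharacter r.

Lemma bichar_perm_invl b : perm_inv (r^~ b).
Proof. by case: r_bichar => H _ _ _ al mu nu eq_mu; apply: H. Qed.

Lemma bichar_perm_invr a : perm_inv (r a).
Proof. by case: r_bichar => H _ _ _ al mu nu eq_mu; apply: H. Qed.

Lemma bichar_bone1 b : r (bone k) b = counit A b.
Proof. by case: r_bichar => _ H _ _; case: (H b). Qed.

Lemma bichar_bone2 b : r b (bone k) = counit A b.
Proof. by case: r_bichar => _ H _ _; case: (H b). Qed.

Lemma bichar_bmul1 a b c :
  r (bmul a b) c = \sum_(p <- cop c) r a p.1 * r b p.2.
Proof. by case: r_bichar. Qed.

Lemma bichar_bmul2 a b c :
  r a (bmul b c) = \sum_(p <- cop a) r p.1 b * r p.2 c.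
Proof. by case: r_bichar. Qed.

(** Cocommutativity reorders the legs of [b] and [d] so that first legs always pair [a] with [c] and
    [b] with [d], while second legs pair across. *)
Lemma bichar_bmul12 a b c d :
  r (bmul a b) (bmul c d) =
  \sum_(w <- cop c) \sum_(x <- cop d) \sum_(y <- cop a) \sum_(z <- cop b)
    (r y.1 w.1 * r y.2 x.2) * (r z.2 w.2 * r z.1 x.1).
Proof.
rewrite bichar_bmul1 (sum_cop_bmul c d (fun u v => r a u * r b v)).
apply: eq_bigr => w _; rewrite (sum_copC d (fun u v => r a (bmul w.1 u) * r b (bmul w.2 v))).
apply: eq_bigr => x _; rewrite !bichar_bmul2 mulr_suml; apply: eq_bigr => y _.
by rewrite (sum_copC b (fun u v => r u w.2 * r v x.1)) mulr_sumr.
Qed.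

Lemma symzE u v :
  symz r u v = \sum_(t <- cop u) \sum_(t' <- cop v) r t.1 t'.2 * r t'.1 t.2.
Proof.
by apply: eq_bigr => t _; exact: (sum_copC v (fun x y => r t.1 x * r y t.2)).
Qed.

(* The Gaussian [r (a', a'') a'''] of a product splits, after reordering
   five-fold coproducts of both factors, into the Gaussians of the factors and
   the two cross terms [r (a, b)] and [r (b, a)] making up [symz r]. *)
Lemma ev_EQB_bmul phi a b :
  ev phi (EQB r (bmul a b)) = ev phi (bullet (symz r) (EQB r a) (EQB r b)).
Proof.
(* Legs of [a]: [p] and [t] enter the first slot of [r], [q] and [u] the second, and [w] is the
   output; primes mark legs of [b]. The pair [p], [q] stays within [a], whereas [t] and [u] meet
   legs of [b]. *)
pose G p t q u w p' t' q' u' w' :=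
  (r p q * r t u') * (r t' u * r p' q') * phi (bmul w w').
transitivity (\sum_(x <- cop a) \sum_(y <- cop x.1) \sum_(z <- cop x.2) \sum_(t <- cop z.1)
    \sum_(x' <- cop b) \sum_(y' <- cop x'.1) \sum_(z' <- cop x'.2) \sum_(t' <- cop z'.1)
    G y.1 y.2 t.1 t.2 z.2 y'.1 y'.2 t'.1 t'.2 z'.2).
  rewrite ev_EQB (sum_cop_bmul a b (fun u v => \sum_(p <- cop v) r u p.1 * phi p.2)).
  apply: eq_bigr => x _; transitivity (\sum_(x' <- cop b) \sum_(z <- cop x.2) \sum_(z' <- cop x'.2)
      \sum_(t <- cop z.1) \sum_(t' <- cop z'.1) \sum_(y <- cop x.1) \sum_(y' <- cop x'.1)
      G y.1 y.2 t.1 t.2 z.2 y'.1 y'.2 t'.1 t'.2 z'.2).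
    apply: eq_bigr => x' _.
    rewrite (sum_cop_bmul x.2 x'.2 (fun u v => r (bmul x.1 x'.1) u * phi v)).
    apply: eq_bigr => z _; apply: eq_bigr => z' _.
    by rewrite bichar_bmul12; do 4![rewrite mulr_suml; apply: eq_bigr => ? _].
  rewrite exchange_big [RHS]exchange_big; apply: eq_bigr => z _.
  under eq_bigr=> x' _ do rewrite exchange_big.
  rewrite exchange_big [RHS]exchange_big; apply: eq_bigr => t _.
  rewrite [RHS]exchange_big; apply: eq_bigr => x' _.
  under eq_bigr=> z' _ do rewrite exchange_big.
  rewrite exchange_big; apply: eq_bigr => y _.
  by rewrite [RHS]exchange_big; apply: eq_bigr => z' _; rewrite exchange_big.
rewrite (sum_cop5 a (fun p t q u w => \sum_(x' <- cop b) \sum_(y' <- cop x'.1)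
  \sum_(z' <- cop x'.2) \sum_(t' <- cop z'.1) G p t q u w y'.1 y'.2 t'.1 t'.2 z'.2)).
rewrite ev_ext2 ev_EQB; apply: eq_bigr => x _; apply: eq_bigr => y _.
transitivity (\sum_(z <- cop y.2) \sum_(t <- cop z.2) \sum_(x' <- cop b) \sum_(y' <- cop x'.2)
    \sum_(z' <- cop y'.2) \sum_(t' <- cop z'.2)
    G x.1 t.1 y.1 t.2 z.1 x'.1 t'.1 y'.1 t'.2 z'.1).
  apply: eq_bigr => z _; apply: eq_bigr => t _.
  exact: (sum_cop5 b (G x.1 t.1 y.1 t.2 z.1)).
rewrite ev_EQB mulr_sumr; under eq_bigr=> z _ do rewrite exchange_big.
rewrite exchange_big; apply: eq_bigr => x' _.
rewrite mulr_sumr; under eq_bigr=> z _ do rewrite exchange_big.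
rewrite exchange_big; apply: eq_bigr => y' _.
rewrite ev_bulletB !mulr_sumr; apply: eq_bigr => z _.
rewrite exchange_big !mulr_sumr; apply: eq_bigr => z' _.
rewrite symzE mulr_suml !mulr_sumr; apply: eq_bigr => t _.
rewrite mulr_suml !mulr_sumr; apply: eq_bigr => t' _.
by rewrite /G; ring.
Qed.

End Bicharacter.
End Evaluation.

(** * [EQ] on generators, and its agreement with the bullet substitution *)

Section Gaussian.
Variables (R : realType) (k : nat) (A : comAlgType R[i]).
Variable r : basis k -> basis k -> A.
Hypothesis r_bichar : bicharacter r.
Implicit Types (X Y : fsum k A) (phi : basis k -> A).

Lemma ev_EQB_grp phi al : ev phi (EQB r (al, [::])) = ev phi (edot r al).
Proof.
rewrite ev_EQB ev_seq1.
rewrite (sum_cop_nil al (fun u v => \sum_(p' <- cop v) r u p'.1 * phi p'.2)).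
exact: (sum_cop_nil al (fun u v => r _ u * phi v)).
Qed.

(** The iterated coproduct of [x_n] has three terms; the two with [x_n] in a slot of [r] vanish by
    the counit axiom. *)
Lemma ev_EQB_bx phi n : ev phi (EQB r (bx k n)) = phi (bx k n).
Proof.
rewrite ev_EQB -[bx k n]/(xcons n (bone k)).
rewrite (sum_cop_xcons n _ (fun u v => \sum_(p' <- cop v) r u p'.1 * phi p'.2)).
rewrite (sum_cop_nil 0 (fun u v => \sum_(p' <- cop v) r (xcons n u) p'.1 * phi p'.2)).
rewrite (sum_cop_nil 0 (fun u v => r _ u * phi v)) bichar_bone2 // mul0r add0r.
rewrite (sum_cop_nil 0 (fun u v => \sum_(p' <- cop (xcons n v)) r u p'.1 * phi p'.2)).
under eq_bigr=> p _ do rewrite bichar_bone1 //.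
exact: sum_cop_counitl.
Qed.

Lemma ev_bullet_congr s X X' Y Y' :
  (forall phi, ev phi X = ev phi X') -> (forall phi, ev phi Y = ev phi Y') ->
  forall phi, ev phi (bullet s X Y) = ev phi (bullet s X' Y').
Proof. by move=> XX' YY' phi; rewrite !ev_ext2 XX'; apply: eq_ev => x. Qed.

(** [EQ] fixes each [x_n] and is multiplicative, so it obeys the recursion that defines [Pdot],
    starting from [r (1, 1) = 1]. *)
Lemma ev_Pdot phi mu : ev phi (Pdot (symz r) mu) = ev phi (EQB r (0, mu)).
Proof.
elim: mu phi => [|n mu IH] phi.
  by rewrite ev_EQB_grp !ev_seq1 bichar_bone1.
rewrite -[n :: mu]/((bx k n).2 ++ mu) -[0]addr0.
rewrite -[(_, _ ++ _)]/(bmul (bx k n) (0, mu)) ev_EQB_bmul //.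
apply: ev_bullet_congr => // psi.
by rewrite ev_EQB_bx // ev_seq1 mul1r.
Qed.

Lemma ev_dot phi X : ev phi (dot r X) = ev phi (EQ r X).
Proof.
rewrite ev_ext ev_EQ; apply: eq_ev => -[al mu] /=.
have -> : (al, mu) = bmul (al, [::]) (0, mu) by rewrite /bmul /= addr0.
rewrite ev_EQB_bmul //; apply: ev_bullet_congr => psi.
  by rewrite ev_EQB_grp.
by rewrite ev_Pdot.
Qed.

Lemma ev_EQ_fmul phi X Y :
  ev phi (EQ r (fmul X Y)) = ev phi (bullet (symz r) (EQ r X) (EQ r Y)).
Proof.
rewrite ev_EQ ev_fmul ev_ext2 ev_EQ; apply: eq_ev => x.
transitivity (ev (fun y => ev (fun u => ev (fun v => ev phi (bulletB (symz r) u v))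
  (EQB r y)) (EQB r x)) Y).
  by apply: eq_ev => y; rewrite ev_EQB_bmul // ev_ext2.
by rewrite ev_exchange; apply: eq_ev => u; rewrite ev_EQ.
Qed.

End Gaussian.

(** * Transposed differential operators of first and second order *)

Section Operators.
Variables (R : realType) (k : nat) (A : comAlgType R[i]).
Local Notation C := R[i].
Implicit Types (X Y : fsum k A) (phi psi : basis k -> A) (g : grp k -> A).
Implicit Types (D : (basis k -> A) -> basis k -> A).

Definition transposes (T : fsum k A -> fsum k A) D : Prop :=
  forall phi X, ev phi (T X) = ev (D phi) X.

(** Linearity over functions of the group component: no summand of Q changes [e^alpha], so
    coefficients depending on alpha pass through. *)
Definition grp_linear D : Prop := forall g phi psi,
  D (fun b => g b.1 * phi b + psi b) = (fun b => g b.1 * D phi b + D psi b).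

(** Dual form of lowering the x-degree: [D phi] at a monomial depends only on [phi] in strictly
    smaller degree. This justifies truncating the exponentials. *)
Definition lowers_degree D : Prop := forall phi n,
  (forall b, (size b.2 < n)%N -> phi b = 0) ->
  forall b, (size b.2 <= n)%N -> D phi b = 0.

Definition preserves_inv D : Prop := forall phi, perm_inv phi -> perm_inv (D phi).

(** Summing over occurrences in the list accounts for the multiplicity produced by d/dx_n. *)
Definition dsum (G : nat -> basis k -> A) (b : basis k) : A :=
  \sum_(n <- b.2) G n (b.1, rem n b.2).

(** The Leibniz rule. Invariance of [G] enters when a later occurrence equals the head [n]: [rem]
    then deletes the head instead of that occurrence. *)
Lemma dsum_xcons G n b : (forall m, perm_inv (G m)) ->
  dsum G (xcons n b) = G n b + dsum (fun m c => G m (xcons n c)) b.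
Proof.
move=> G_inv; rewrite /dsum /= big_cons eqxx -surjective_pairing; congr (_ + _).
apply: eq_big_seq => m.
by case: eqP => // <- n_b; apply: G_inv; apply: perm_to_rem.
Qed.

Lemma perm_inv_dsum G : (forall m, perm_inv (G m)) -> perm_inv (dsum G).
Proof.
move=> G_inv al mu nu mu_nu; rewrite /dsum /= (perm_big _ mu_nu).
apply: eq_big_seq => m m_nu; apply: G_inv.
have m_mu : m \in mu by rewrite (perm_mem mu_nu).
by rewrite -(perm_cons m) -(permPl (perm_to_rem m_mu)) -(permPr (perm_to_rem m_nu)).
Qed.

Lemma dsum_eq0 G n : (forall m b, (size b.2 < n)%N -> G m b = 0) ->
  forall b, (size b.2 <= n)%N -> dsum G b = 0.
Proof.
move=> G0 b b_n; rewrite /dsum big_seq_cond big1 // => m /andP[m_b _].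
by rewrite G0 //= size_rem // -ltnS prednK //; case: (b.2) m_b.
Qed.

(** Transpose of sum_n be_n d/dx_n with coefficients depending on alpha. It covers the second and
    third summands of Q as well as the d/dx part of [D_n]. *)
Definition Lop (be : nat -> grp k -> A) phi := dsum (fun n b => be n b.1 * phi b).

Definition Kop (q : nat -> nat -> A) phi := dsum (fun n => Lop (fun m _ => q m n) phi).

Lemma perm_inv_Lop be : preserves_inv (Lop be).
Proof.
move=> phi phi_inv; apply: perm_inv_dsum => m al mu nu mu_nu /=.
by rewrite (phi_inv al mu nu).
Qed.

Lemma perm_inv_Kop q : preserves_inv (Kop q).
Proof. by move=> phi phi_inv; apply: perm_inv_dsum => m; apply: perm_inv_Lop. Qed.

Lemma Lop_lowers be : lowers_degree (Lop be).
Proof. by move=> phi n phi0; apply: dsum_eq0 => m b b_n; rewrite phi0 ?mulr0. Qed.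

Lemma Kop_lowers q : lowers_degree (Kop q).
Proof.
move=> phi n phi0; apply: dsum_eq0 => m b b_n.
exact: (@Lop_lowers _ _ n phi0 b (ltnW b_n)).
Qed.

Lemma Lop_grp_linear be : grp_linear (Lop be).
Proof.
move=> g phi psi; apply: funext => b; rewrite /Lop /dsum mulr_sumr -big_split.
by apply: eq_bigr => m _ /=; rewrite mulrDr mulrCA.
Qed.

Lemma Kop_grp_linear q : grp_linear (Kop q).
Proof.
move=> g phi psi; apply: funext => b; rewrite /Kop /dsum mulr_sumr -big_split.
by apply: eq_bigr => m _ /=; rewrite Lop_grp_linear.
Qed.

Lemma Lop_xcons be phi n b : perm_inv phi ->
  Lop be phi (xcons n b) = be n b.1 * phi b + Lop be (phi \o xcons n) b.
Proof.
move=> phi_inv; rewrite /Lop dsum_xcons // => m al mu nu mu_nu /=.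
by rewrite (phi_inv al mu nu).
Qed.

(** The head [x_n] is removed by the outer sum, by the inner sum, or by neither; the first two cases
    produce the symmetrized coefficients. *)
Lemma Kop_xcons q phi n b : perm_inv phi ->
  Kop q phi (xcons n b) =
  Lop (fun m _ => q m n + q n m) phi b + Kop q (phi \o xcons n) b.
Proof.
move=> phi_inv; rewrite /Kop dsum_xcons => [|m]; last exact: perm_inv_Lop.
rewrite (_ : dsum _ b = dsum (fun m c => q n m * phi c) b +
    dsum (fun m => Lop (fun p _ => q p m) (phi \o xcons n)) b); last first.
  rewrite /dsum -big_split; apply: eq_bigr => m _ /=.
  exact: Lop_xcons.
rewrite addrA; congr (_ + _); rewrite /Lop /dsum -big_split.
by apply: eq_bigr => m _; rewrite mulrDl.
Qed.

End Operators.

(** * Commutation relations, truncated exponentials and the transposes of the summands of Q *)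

Section Exponential.
Variables (R : realType) (k : nat) (A : comAlgType R[i]).
Local Notation C := R[i].
Implicit Types (X Y : fsum k A) (phi psi : basis k -> A) (g : grp k -> A).
Implicit Types (D : (basis k -> A) -> basis k -> A).

Lemma perm_inv_xcons phi n : perm_inv phi -> perm_inv (phi \o xcons n).
Proof. by move=> phi_inv al mu nu mu_nu; apply: phi_inv; rewrite perm_cons. Qed.

Lemma Lop_comp_xcons be phi n : perm_inv phi ->
  Lop be phi \o xcons n = fun b => be n b.1 * phi b + Lop be (phi \o xcons n) b.
Proof. by move=> phi_inv; apply: funext => b; apply: Lop_xcons. Qed.

(** On a monomial with head [x_n] both orders of composition yield the same two extra terms, [be n]
    times [Lop ga phi] and [ga n] times [Lop be phi]; induction handles the rest. *)
Lemma LopC be ga phi : perm_inv phi -> Lop be (Lop ga phi) = Lop ga (Lop be phi).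
Proof.
move=> phi_inv; apply: funext => -[al mu].
elim: mu phi phi_inv => [|n mu IH] phi phi_inv; first by rewrite /Lop /dsum !big_nil.
rewrite -[(al, _)]/(xcons n (al, mu)) !Lop_xcons; try exact: perm_inv_Lop.
rewrite !Lop_comp_xcons // !Lop_grp_linear (IH (phi \o xcons n)) ?addrA; last first.
  exact: perm_inv_xcons.
by congr (_ + _); apply: addrC.
Qed.

Lemma Kop_LopC q be phi : perm_inv phi -> Kop q (Lop be phi) = Lop be (Kop q phi).
Proof.
move=> phi_inv; apply: funext => -[al mu].
elim: mu phi phi_inv => [|n mu IH] phi phi_inv; first by rewrite /Kop /Lop /dsum !big_nil.
rewrite -[(al, _)]/(xcons n (al, mu)) Kop_xcons; last exact: perm_inv_Lop.
rewrite Lop_xcons; last exact: perm_inv_Kop.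
rewrite Lop_comp_xcons // Kop_grp_linear (IH (phi \o xcons n)); last exact: perm_inv_xcons.
(* The factor 1 gives the sum the shape demanded by [grp_linear]. *)
have -> : Kop q phi \o xcons n = fun b => 1 * Lop (fun m _ => q m n + q n m) phi b +
    Kop q (phi \o xcons n) b.
  by apply: funext => b; rewrite /= Kop_xcons // mul1r.
by rewrite (Lop_grp_linear _ (fun=> 1)) mul1r LopC // addrCA.
Qed.

Lemma iter_lowers D phi j b :
  lowers_degree D -> (size b.2 < j)%N -> iter j D phi b = 0.
Proof. by move=> D_low; elim: j b => // j IH b b_j; apply: (D_low _ j). Qed.

Lemma iter_grp_linear D j : grp_linear D -> grp_linear (iter j D).
Proof. by move=> D_lin g phi psi; elim: j => //= j ->. Qed.

Lemma iter_preserves_inv D j : preserves_inv D -> preserves_inv (iter j D).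
Proof. by move=> D_inv phi phi_inv; elim: j => //= j; apply: D_inv. Qed.

(** The truncation depends on the degree of the point [b], whereas [lfexp] truncates at the degree
    of the whole element; [lexp_widen] reconciles the two. *)
Definition lexp D phi (b : basis k) : A :=
  \sum_(j <- iota 0 (size b.2).+1) ((j`!%:R : C)^-1)%:A * iter j D phi b.

Lemma lexp_widen D phi b N : lowers_degree D -> (size b.2 <= N)%N ->
  lexp D phi b = \sum_(j <- iota 0 N.+1) ((j`!%:R : C)^-1)%:A * iter j D phi b.
Proof.
move=> D_low b_N; rewrite /lexp -(subnKC b_N) -addSn iotaD big_cat /=.
rewrite -[LHS]addr0; congr (_ + _).
rewrite big_seq big1 // => j; rewrite mem_iota => /andP[b_j _].
by rewrite iter_lowers // mulr0.
Qed.

Lemma lexp_nil D phi al : lexp D phi (al, [::]) = phi (al, [::]).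
Proof. by rewrite /lexp /= big_seq1 fact0 invr1 scale1r mul1r. Qed.

Lemma lexp_grp_linear D : grp_linear D -> grp_linear (lexp D).
Proof.
move=> D_lin g phi psi; apply: funext => b; rewrite /lexp mulr_sumr -big_split.
by apply: eq_bigr => j _; rewrite iter_grp_linear // mulrDr mulrCA.
Qed.

Lemma lexp_preserves_inv D : preserves_inv D -> preserves_inv (lexp D).
Proof.
move=> D_inv phi phi_inv al mu nu mu_nu; rewrite /lexp /= (perm_size mu_nu).
by apply: eq_bigr => j _; congr (_ * _); apply: iter_preserves_inv.
Qed.

(* Transpose of [exp(D) x_n = (x_n + E) exp(D)], where [E = [D, x_n]] commutes
   with [D]. *)
Lemma lexp_xcons D (E : (basis k -> A) -> basis k -> A) n phi b :
  grp_linear D -> preserves_inv D -> lowers_degree D ->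
  (forall psi c, perm_inv psi -> D psi (xcons n c) = E psi c + D (psi \o xcons n) c) ->
  (forall psi, perm_inv psi -> E (D psi) = D (E psi)) ->
  perm_inv phi ->
  lexp D phi (xcons n b) = lexp D (E phi) b + lexp D (phi \o xcons n) b.
Proof.
move=> D_lin D_inv D_low DE ED phi_inv.
have E_iter j : E (iter j D phi) = iter j D (E phi).
  by elim: j => //= j <-; apply: ED; apply: iter_preserves_inv.
(* This is the transpose of [[D^j, x_n] = j E D^(j-1)]. At [j = 0] the factor 0 makes the default
   value of [j.-1] harmless. *)
have iterE j : iter j D phi \o xcons n =
    fun c => j%:R * iter j.-1 D (E phi) c + iter j D (phi \o xcons n) c.
  elim: j => [|j IH]; apply: funext => c; first by rewrite mul0r add0r.
  rewrite /= DE; last exact: iter_preserves_inv.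
  rewrite IH (D_lin (fun=> _)) E_iter addrA mulrSr mulrDl mul1r addrC [RHS]addrC.
  congr (_ + _); rewrite [LHS]addrC; congr (_ + _).
  by case: (j) => [|i] //; rewrite !mul0r.
have {}iterE j c : iter j D phi (xcons n c) =
    j%:R * iter j.-1 D (E phi) c + iter j D (phi \o xcons n) c.
  by rewrite -[LHS]/((iter j D phi \o xcons n) c) iterE.
rewrite /lexp -[size (xcons n b).2]/(size b.2).+1.
under eq_bigr=> j _ do rewrite iterE mulrDr.
rewrite big_split; congr (_ + _); last first.
  by rewrite -[RHS]/(lexp D _ b) (lexp_widen _ D_low (leqnSn _)).
(* The term of index 0 vanishes, and shifting the index turns j / j! into 1 / (j-1)!. *)
rewrite -[iota 0 (size b.2).+2]/(0%N :: iota 1 (size b.2).+1).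
rewrite big_cons mul0r mulr0 [LHS]add0r (iotaDl 1 0) big_map.
apply: eq_bigr => j _; rewrite add1n /= mulrA; congr (_ * _).
rewrite mulr_natr scalerMnl factS natrM invfM -mulr_natr mulrAC mulVf ?mul1r //.
by rewrite pnatr_eq0.
Qed.

Lemma transposes_iter T D j : transposes T D -> transposes (iter j T) (iter j D).
Proof.
move=> TD; elim: j => // j IH phi X.
by rewrite [LHS]TD IH -iterSr.
Qed.

Lemma transposes_lfexp (T : fsum k A -> fsum k A) D :
  transposes T D -> lowers_degree D -> transposes (lfexp T) (lexp D).
Proof.
move=> TD D_low phi X; rewrite ev_flatten.
under eq_bigr=> j _ do rewrite ev_scl (transposes_iter j TD) mulr_sumr.
rewrite exchange_big; apply: eq_big_seq => t t_X.
rewrite (@lexp_widen _ _ _ (xdeg X)) //; last exact: leq_bigmax_seq.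
by rewrite mulr_sumr; apply: eq_bigr => j _; rewrite mulrCA.
Qed.

Lemma transposes_dalpha i :
  @transposes R k A (dalpha i) (fun phi b => (b.1 i)%:~R * phi b).
Proof. by move=> phi X; rewrite ev_ext; apply: eq_ev => b; rewrite ev_seq1. Qed.

Lemma transposes_dx n :
  @transposes R k A (dx n) (fun phi b => (count_mem n b.2)%:R * phi (b.1, rem n b.2)).
Proof. by move=> phi X; rewrite ev_ext; apply: eq_ev => b; rewrite ev_seq1. Qed.

(** Passes from the sum over all variables of an element, weighted by multiplicity, to the sum over
    occurrences in one monomial; absent variables have weight 0. *)
Lemma sum_count_mem (s mu : seq nat) (F : nat -> A) : uniq s -> {subset mu <= s} ->
  \sum_(n <- s) (count_mem n mu)%:R * F n = \sum_(n <- mu) F n.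
Proof.
move=> s_uniq; elim: mu => [|m mu IH] mu_s.
  by rewrite big_nil big1 // => n _; rewrite mul0r.
rewrite big_cons -IH => [|n n_mu]; last by rewrite mu_s // inE n_mu orbT.
under eq_bigr=> n _ do rewrite /= natrD mulrDl.
rewrite big_split (bigD1_seq m) ?mu_s ?inE ?eqxx //= mul1r big1 ?addr0 // => n.
by rewrite eq_sym => /negPf ->; rewrite mul0r.
Qed.

Lemma sub_vars X t : t \in X -> {subset t.2.2 <= vars X}.
Proof.
move=> t_X n n_t; rewrite mem_undup; apply/flatten_mapP.
by exists t.
Qed.

(** The range [vars X] depends on [X], but after transposition each monomial sees only its own
    variables, so the operator is linear. *)
Lemma transposes_Q2 (be : 'I_k -> nat -> A) :
  transposes (Q2 be) (Lop (fun n al => \sum_i be i n * (al i)%:~R)).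
Proof.
move=> phi X; rewrite ev_allpairs.
under eq_bigr=> i _ do under eq_bigr=> n _ do
  rewrite ev_scl transposes_dalpha transposes_dx mulr_sumr.
under eq_bigr=> i _ do rewrite exchange_big.
rewrite exchange_big; apply: eq_big_seq => t t_X.
rewrite exchange_big /Lop /dsum -(@sum_count_mem (vars X)) ?undup_uniq; first last.
- exact: sub_vars.
- by [].
rewrite mulr_sumr; apply: eq_bigr => n _.
rewrite big_enum /= mulr_suml !mulr_sumr; apply: eq_bigr => i _ /=.
by ring.
Qed.

Lemma transposes_Q3 (ga : nat -> 'I_k -> A) :
  transposes (Q3 ga) (Lop (fun n al => \sum_i ga n i * (al i)%:~R)).
Proof.
move=> phi X; rewrite ev_allpairs.
under eq_bigr=> n _ do under eq_bigr=> i _ do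
  rewrite ev_scl transposes_dx transposes_dalpha mulr_sumr.
under eq_bigr=> n _ do rewrite exchange_big.
rewrite exchange_big; apply: eq_big_seq => t t_X.
rewrite /Lop /dsum -(@sum_count_mem (vars X)) ?undup_uniq; first last.
- exact: sub_vars.
- by [].
rewrite mulr_sumr; apply: eq_bigr => n _.
rewrite big_enum /= mulr_suml !mulr_sumr; apply: eq_bigr => i _ /=.
by ring.
Qed.

Lemma transposes_Q4 (q : nat -> nat -> A) : @transposes R k A (Q4 q) (Kop q).
Proof.
move=> phi X; rewrite ev_allpairs.
under eq_bigr=> m _ do under eq_bigr=> n _ do
  rewrite ev_scl transposes_dx transposes_dx mulr_sumr.
under eq_bigr=> m _ do rewrite exchange_big.
rewrite exchange_big; apply: eq_big_seq => t t_X.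
rewrite exchange_big /Kop /dsum -(@sum_count_mem (vars X)) ?undup_uniq; first last.
- exact: sub_vars.
- by [].
rewrite mulr_sumr; apply: eq_bigr => n _.
rewrite /Lop /dsum -(@sum_count_mem (vars X)) ?undup_uniq; first last.
- by move=> m /mem_rem; apply: sub_vars.
- by [].
rewrite !mulr_sumr; apply: eq_bigr => m _ /=.
by ring.
Qed.

End Exponential.

(** * Characters and additive maps on the free abelian group G *)

Section GroupMaps.
Variables (R : realType) (k : nat) (A : comAlgType R[i]).
Local Notation C := R[i].

Lemma grp_gen_ind (P : grp k -> Prop) :
  (forall i, P (bgen i).1) -> (forall x y, P x -> P y -> P (x + y)) ->
  (forall x, P x -> P (- x)) -> P 0 -> forall x, P x.
Proof.
move=> Pgen PD PN P0 x.
(* Integer multiples of one generator come first, by induction from 0 in both directions; a general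
   element is a sum of these. *)
have Psingle i z : P [ffun j => (i == j)%:Z * z].
  elim/int_rect: z => [|n IH|n IH].
  - by rewrite (_ : finfun _ = 0) //; apply/ffunP=> j; rewrite !ffunE mulr0.
  - rewrite (_ : finfun _ = [ffun j => (i == j)%:Z * n%:Z] + (bgen i).1); first exact: PD.
    by apply/ffunP=> j; rewrite !ffunE intS mulrDr mulr1 addrC.
  rewrite (_ : finfun _ = [ffun j => (i == j)%:Z * - n%:Z] - (bgen i).1).
    by apply: PD => //; apply: PN.
  by apply/ffunP=> j; rewrite !ffunE intS opprD mulrDr mulrN1 addrC.
rewrite (_ : x = \sum_i [ffun j => (i == j)%:Z * x i]); first exact: big_ind.
apply/ffunP=> j; rewrite sum_ffunE (bigD1 j) //= ffunE eqxx mul1r big1 ?addr0 //.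
by move=> i /negPf; rewrite ffunE => ->; rewrite mul0r.
Qed.

Lemma sum_bgen (S : pzRingType) (z : 'I_k -> S) i :
  \sum_j z j * (((bgen i).1 : grp k) j)%:~R = z i.
Proof.
rewrite (bigD1 i) //= ffunE eqxx mulr1 big1 ?addr0 // => j.
by rewrite ffunE eq_sym => /negPf ->; rewrite mulr0.
Qed.

Lemma cexpD (x y : C) : cexp (x + y) = cexp x * cexp y.
Proof.
case: x y => [x1 x2] [y1 y2]; rewrite /cexp.
rewrite -[LHS]/(Complex (expR (x1 + y1) * cos (x2 + y2)) (expR (x1 + y1) * sin (x2 + y2))).
rewrite expRD cosD sinD.
by apply/eqP; rewrite eq_complex /=; apply/andP; split; apply/eqP; ring.
Qed.

Lemma cexp0 : cexp (0 : C) = 1.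
Proof. by rewrite /cexp /= expR0 cos0 sin0 mulr0 mulr1. Qed.

Lemma grp_exp (f : grp k -> A) (z : 'I_k -> C) :
  f 0 = 1 -> (forall x y, f (x + y) = f x * f y) ->
  (forall i, f (bgen i).1 = (cexp (z i))%:A) ->
  forall x, f x = (cexp (\sum_i z i * (x i)%:~R))%:A.
Proof.
move=> f0 fD fgen; elim/grp_gen_ind => [i|x y IHx IHy|x IH|].
- by rewrite sum_bgen.
- rewrite fD IHx IHy -scalerAl mul1r scalerA -cexpD -big_split.
  by congr (cexp _)%:A; apply: eq_bigr => i _; rewrite ffunE rmorphD mulrDr.
- set u := \sum_i _; have -> : u = - \sum_i z i * (x i)%:~R.
    by rewrite -sumrN; apply: eq_bigr => i _; rewrite ffunE rmorphN mulrN.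
  set v := \sum_i _ in IH *.
  (* An explicit inverse of [f x] is exhibited, since [A] is only a commutative algebra;
     [f (- x) * f x = 1] then determines [f (- x)]. *)
  have fx_inv : f x * (cexp (- v))%:A = 1.
    by rewrite IH -scalerAl mul1r scalerA -cexpD subrr cexp0 scale1r.
  transitivity (f (- x) * (f x * (cexp (- v))%:A)); first by rewrite fx_inv mulr1.
  by rewrite mulrA -fD addNr f0 mul1r.
- by rewrite f0 big1 ?cexp0 ?scale1r // => i _; rewrite ffunE mulr0.
Qed.

Lemma grp_additive (f : grp k -> A) (z : 'I_k -> A) :
  (forall x y, f (x + y) = f x + f y) -> (forall i, f (bgen i).1 = z i) ->
  forall x, f x = \sum_i z i * (x i)%:~R.
Proof.
move=> fD fgen.
have f0 : f 0 = 0 by apply: (addrI (f 0)); rewrite -fD !addr0.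
elim/grp_gen_ind => [i|x y IHx IHy|x IH|].
- by rewrite sum_bgen.
- rewrite fD IHx IHy -big_split.
  by apply: eq_bigr => i _; rewrite ffunE rmorphD mulrDr.
- apply: (addIr (f x)); rewrite -fD addNr f0 IH -big_split big1 // => i _.
  by rewrite ffunE rmorphN mulrN /= addNr.
- by rewrite f0 big1 // => i _; rewrite ffunE mulr0.
Qed.

End GroupMaps.

(** * Pairings with primitive elements, and bullet-multiplication by a variable *)

Section BicharacterValues.
Variables (R : realType) (k : nat) (A : comAlgType R[i]).
Variable r : basis k -> basis k -> A.
Hypothesis r_bichar : bicharacter r.
Implicit Types (phi : basis k -> A) (al be : grp k).

Lemma bmul_grp al be : (al + be, [::]) = bmul (al, [::]) (be, [::]) :> basis k.
Proof. by []. Qed.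

Lemma bmul_bx n b : bmul (bx k n) b = xcons n b.
Proof. by rewrite /bmul /= add0r. Qed.

Lemma bmul_bone b : bmul (bone k) b = b.
Proof. by case: b => al mu; rewrite /bmul /= add0r. Qed.

Lemma bichar_grpD1 al be c :
  r (al + be, [::]) (c, [::]) = r (al, [::]) (c, [::]) * r (be, [::]) (c, [::]).
Proof.
rewrite bmul_grp bichar_bmul1 //.
exact: (sum_cop_nil c (fun u v => r _ u * r _ v)).
Qed.

Lemma bichar_grpD2 al be c :
  r (c, [::]) (al + be, [::]) = r (c, [::]) (al, [::]) * r (c, [::]) (be, [::]).
Proof.
rewrite bmul_grp bichar_bmul2 //.
exact: (sum_cop_nil c (fun u v => r u _ * r v _)).
Qed.

(** Primitivity of [x_n] and [r (e^alpha, 1) = 1] make this pairing additive, while the pairing of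
    two grouplikes is multiplicative. *)
Lemma bichar_grp_bx al be n :
  r (al + be, [::]) (bx k n) = r (al, [::]) (bx k n) + r (be, [::]) (bx k n).
Proof.
rewrite bmul_grp bichar_bmul1 // -[bx k n]/(xcons n (bone k)).
rewrite (sum_cop_xcons n _ (fun u v => r _ u * r _ v)).
rewrite (sum_cop_nil 0 (fun u v => r _ (xcons n u) * r _ v)).
rewrite (sum_cop_nil 0 (fun u v => r _ u * r _ (xcons n v))).
by rewrite !bichar_bone2 // mulr1 mul1r.
Qed.

Lemma bichar_bx_grp al be n :
  r (bx k n) (al + be, [::]) = r (bx k n) (al, [::]) + r (bx k n) (be, [::]).
Proof.
rewrite bmul_grp bichar_bmul2 // -[bx k n]/(xcons n (bone k)).
rewrite (sum_cop_xcons n _ (fun u v => r u _ * r v _)).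
rewrite (sum_cop_nil 0 (fun u v => r (xcons n u) _ * r v _)).
rewrite (sum_cop_nil 0 (fun u v => r u _ * r (xcons n v) _)).
by rewrite !bichar_bone1 // mulr1 mul1r.
Qed.

(** One leg of the coproduct of [x_n] is always 1, and [r (1, x_m) = 0]; hence [x_n] pairs to 0 with
    monomials of x-degree at least two. *)
Lemma bichar_bx_xcons n m b :
  r (bx k n) (xcons m b) = r (bx k n) (bx k m) * counit A b.
Proof.
rewrite -bmul_bx bichar_bmul2 // -[bx k n]/(xcons n (bone k)).
rewrite (sum_cop_xcons n _ (fun u v => r u _ * r v _)).
rewrite (sum_cop_nil 0 (fun u v => r (xcons n u) _ * r v _)).
rewrite (sum_cop_nil 0 (fun u v => r u _ * r (xcons n v) _)).
by rewrite !bichar_bone1 // mul0r addr0.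
Qed.

Lemma bichar_xcons_bx n m b :
  r (xcons m b) (bx k n) = r (bx k m) (bx k n) * counit A b.
Proof.
rewrite -bmul_bx bichar_bmul1 // -[bx k n]/(xcons n (bone k)).
rewrite (sum_cop_xcons n _ (fun u v => r _ u * r _ v)).
rewrite (sum_cop_nil 0 (fun u v => r _ (xcons n u) * r _ v)).
rewrite (sum_cop_nil 0 (fun u v => r _ u * r _ (xcons n v))).
by rewrite !bichar_bone2 // mul0r addr0.
Qed.

Lemma symz_bone1 c : symz r (bone k) c = counit A c.
Proof.
rewrite /symz /conv.
rewrite (sum_cop_nil 0 (fun u v => \sum_(p' <- cop c) r u p'.1 * transp r v p'.2)).
under eq_bigr=> p _ do rewrite /transp bichar_bone1 // bichar_bone2 //.
exact: sum_cop_counitl.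
Qed.

Lemma symz_bx n c : symz r (bx k n) c = r (bx k n) c + r c (bx k n).
Proof.
rewrite /symz /conv -[bx k n]/(xcons n (bone k)).
rewrite (sum_cop_xcons n _ (fun u v => \sum_(p' <- cop c) r u p'.1 * transp r v p'.2)).
rewrite (sum_cop_nil 0 (fun u v => \sum_(p' <- cop c) r (xcons n u) p'.1 * transp r v p'.2)).
rewrite (sum_cop_nil 0 (fun u v => \sum_(p' <- cop c) r u p'.1 * transp r (xcons n v) p'.2)).
rewrite /transp; under eq_bigr=> p _ do rewrite bichar_bone2 //.
under [X in _ + X]eq_bigr=> p _ do rewrite bichar_bone1 //.
by rewrite (sum_cop_counitl c (r^~ _)) (sum_cop_counitr c (r _)).
Qed.

(** As [S] is supported in x-degree at most one, contracting a leg with it is a differential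
    operator of order at most one. *)
Lemma sum_cop_primitive (S phi : basis k -> A) (e : nat -> A) b :
  (forall m c, S (xcons m c) = e m * counit A c) -> perm_inv phi ->
  \sum_(p <- cop b) S p.2 * phi p.1 =
  S (b.1, [::]) * phi b + Lop (fun m _ => e m) phi b.
Proof.
move=> Se; case: b => al mu; elim: mu phi => [|n mu IH] phi phi_inv.
  rewrite (sum_cop_nil al (fun u v => S v * phi u)).
  by rewrite /Lop /dsum big_nil addr0.
rewrite -[(al, n :: mu)]/(xcons n (al, mu)).
rewrite (sum_cop_xcons n _ (fun u v => S v * phi u)) (IH (phi \o xcons n)); last first.
  exact: perm_inv_xcons.
under eq_bigr=> p _ do rewrite Se -mulrA.
rewrite -mulr_sumr (_ : \sum_(p <- _) _ = phi (al, mu)); last first.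
  rewrite -[RHS]sum_cop_counitr; apply: eq_bigr => p _; exact: mulrC.
by rewrite Lop_xcons // -addrA [X in _ + X = _]addrC.
Qed.

(** This is [x_n + D_n]: keeping [x_n] in the output leg gives the multiplication, and sending it
    into [symz r] gives [D_n]. *)
Lemma ev_bulletB_bx phi n b : perm_inv phi ->
  ev phi (bulletB (symz r) (bx k n) b) =
  (r (b.1, [::]) (bx k n) + r (bx k n) (b.1, [::])) * phi b +
  (Lop (fun m _ => r (bx k m) (bx k n) + r (bx k n) (bx k m)) phi b + phi (xcons n b)).
Proof.
move=> phi_inv; rewrite ev_bulletB -[bx k n in LHS]/(xcons n (bone k)).
rewrite (sum_cop_xcons n _
  (fun u v => \sum_(p' <- cop b) symz r v p'.2 * phi (bmul u p'.1))).
rewrite (sum_cop_nil 0 (fun u v =>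
  \sum_(p' <- cop b) symz r v p'.2 * phi (bmul (xcons n u) p'.1))).
rewrite (sum_cop_nil 0 (fun u v =>
  \sum_(p' <- cop b) symz r (xcons n v) p'.2 * phi (bmul u p'.1))).
under eq_bigr=> p _ do rewrite symz_bone1 bmul_bx mulrC.
under [X in _ + X]eq_bigr=> p _ do rewrite symz_bx bmul_bone.
rewrite (sum_cop_counitr b (phi \o xcons n)).
rewrite (@sum_cop_primitive (fun c => r (bx k n) c + r c (bx k n)) phi
  (fun m => r (bx k m) (bx k n) + r (bx k n) (bx k m))) //; last first.
  by move=> m c; rewrite bichar_bx_xcons bichar_xcons_bx -mulrDl addrC.
by rewrite [RHS]addrA addrC [r _ (bx k n) + _]addrC.
Qed.

Lemma perm_inv_sum I (s : seq I) (F : I -> basis k -> A) :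
  (forall i, perm_inv (F i)) -> perm_inv (fun b => \sum_(i <- s) F i b).
Proof. by move=> F_inv al mu nu mu_nu; apply: eq_bigr => i _; apply: F_inv. Qed.

Lemma perm_inv_mull c phi : perm_inv phi -> perm_inv (fun b => c * phi b).
Proof. by move=> phi_inv al mu nu mu_nu; rewrite (phi_inv _ _ _ mu_nu). Qed.

Lemma perm_inv_mulr c phi : perm_inv phi -> perm_inv (fun b => phi b * c).
Proof. by move=> phi_inv al mu nu mu_nu; rewrite (phi_inv _ _ _ mu_nu). Qed.

Lemma perm_inv_symzl c : perm_inv ((symz r)^~ c).
Proof.
apply: (perm_inv_sum_cop (F := fun u v =>
  \sum_(p' <- cop c) r u p'.1 * transp r v p'.2)) => [v|u].
  by apply: perm_inv_sum => p; apply: perm_inv_mulr; apply: bichar_perm_invl.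
by apply: perm_inv_sum => p; apply: perm_inv_mull; apply: bichar_perm_invr.
Qed.

Lemma perm_inv_symzr a : perm_inv (symz r a).
Proof.
apply: perm_inv_sum => p.
apply: (perm_inv_sum_cop (F := fun u v => r p.1 u * transp r p.2 v)) => [v|u].
  by apply: perm_inv_mulr; apply: bichar_perm_invr.
by apply: perm_inv_mull; apply: bichar_perm_invl.
Qed.

Lemma perm_inv_bmull phi b : perm_inv phi -> perm_inv (fun a => phi (bmul a b)).
Proof. by move=> phi_inv al mu nu mu_nu; apply: phi_inv; rewrite perm_cat2r. Qed.

Lemma perm_inv_bmulr phi a : perm_inv phi -> perm_inv (fun b => phi (bmul a b)).
Proof. by move=> phi_inv al mu nu mu_nu; apply: phi_inv; rewrite perm_cat2l. Qed.

Lemma perm_inv_bulletBl phi b : perm_inv phi ->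
  perm_inv (fun a => ev phi (bulletB (symz r) a b)).
Proof.
move=> phi_inv al mu nu mu_nu; rewrite !ev_bulletB; move: al mu nu mu_nu.
apply: (perm_inv_sum_cop (F := fun u v =>
  \sum_(p' <- cop b) symz r v p'.2 * phi (bmul u p'.1))) => [v|u].
  by apply: perm_inv_sum => p; apply: perm_inv_mull; apply: perm_inv_bmull.
by apply: perm_inv_sum => p; apply: perm_inv_mulr; apply: perm_inv_symzl.
Qed.

Lemma perm_inv_bulletBr phi a : perm_inv phi ->
  perm_inv (fun b => ev phi (bulletB (symz r) a b)).
Proof.
move=> phi_inv al mu nu mu_nu; rewrite !ev_bulletB; move: al mu nu mu_nu.
apply: (@perm_inv_sum _ (cop a) (fun p b =>
  \sum_(p' <- cop b) symz r p.2 p'.2 * phi (bmul p.1 p'.1))) => p.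
apply: (perm_inv_sum_cop (F := fun u v => symz r p.2 v * phi (bmul p.1 u))) => [v|u].
  by apply: perm_inv_mull; apply: perm_inv_bmulr.
by apply: perm_inv_mulr; apply: perm_inv_symzr.
Qed.

Lemma bullet_equiv X X' Y Y' : fs_equiv X X' -> fs_equiv Y Y' ->
  fs_equiv (bullet (symz r) X Y) (bullet (symz r) X' Y').
Proof.
move=> XX' YY' phi phi_inv; rewrite !ev_ext2 XX'; last first.
  apply: perm_inv_sum => t; apply: perm_inv_mull; exact: perm_inv_bulletBl.
by apply: eq_ev => a; apply: YY'; apply: perm_inv_bulletBr.
Qed.

End BicharacterValues.

(** * The transpose of [e^Q] and its comparison with [EQ] *)

Section ExpQ.
Variables (R : realType) (k : nat) (A : comAlgType R[i]).
Variables (r : basis k -> basis k -> A) (a : 'I_k -> 'I_k -> R[i])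
  (b : 'I_k -> nat -> A) (c : nat -> 'I_k -> A) (q : nat -> nat -> A).
Implicit Types (phi : basis k -> A) (al be : grp k) (X Y : fsum k A).

Definition gauss al : R[i] := cexp (\sum_i \sum_j a i j * (al i * al j)%:~R).
Definition coefb n al : A := \sum_i b i n * (al i)%:~R.
Definition coefc n al : A := \sum_i c n i * (al i)%:~R.

(** Transposition reverses the order of the four exponentials in [expQ]. *)
Definition expQT phi (x : basis k) : A :=
  (gauss x.1)%:A * lexp (Lop coefb) (lexp (Lop coefc) (lexp (Kop q) phi)) x.

Lemma transposes_expQ : transposes (expQ a b c q) expQT.
Proof.
move=> phi X; rewrite /expQ.
rewrite (transposes_lfexp (@transposes_Q4 _ _ _ q)); last exact: Kop_lowers.
rewrite (transposes_lfexp (@transposes_Q3 _ _ _ c)); last exact: Lop_lowers.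
rewrite (transposes_lfexp (@transposes_Q2 _ _ _ b)); last exact: Lop_lowers.
by rewrite ev_ext; apply: eq_ev => x; rewrite ev_seq1.
Qed.

Lemma lexp_Lop_xcons e n phi x : perm_inv phi ->
  lexp (Lop e) phi (xcons n x) =
  e n x.1 * lexp (Lop e) phi x + lexp (Lop e) (phi \o xcons n) x.
Proof.
move=> phi_inv.
(* [grp_linear] speaks of [g * phi + psi] only; taking [g = e n - 1] and [psi = phi] yields pure
   multiplication by [e n]. *)
have mulE psi :
    (fun x => e n x.1 * psi x) = (fun x => (e n x.1 - 1) * psi x + psi x) :> (basis k -> A).
  by apply: funext => y; rewrite mulrBl mul1r subrK.
have mul_lin D : @grp_linear R k A D -> forall psi,
    D (fun x => e n x.1 * psi x) = fun x => e n x.1 * D psi x.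
  by move=> D_lin psi; rewrite mulE (D_lin (fun al => e n al - 1)) mulE.
rewrite (@lexp_xcons _ _ _ _ (fun psi x => e n x.1 * psi x)) //.
- by rewrite mul_lin //; apply: lexp_grp_linear; apply: Lop_grp_linear.
- exact: Lop_grp_linear.
- exact: perm_inv_Lop.
- exact: Lop_lowers.
- by move=> psi y psi_inv; apply: Lop_xcons.
- by move=> psi _; rewrite mul_lin //; apply: Lop_grp_linear.
Qed.

Lemma lexp_Kop_xcons n phi x : perm_inv phi ->
  lexp (Kop q) phi (xcons n x) =
  lexp (Kop q) (Lop (fun m _ => q m n + q n m) phi) x + lexp (Kop q) (phi \o xcons n) x.
Proof.
move=> phi_inv; apply: lexp_xcons => //.
- exact: Kop_grp_linear.
- exact: perm_inv_Kop.
- exact: Kop_lowers.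
- by move=> psi y psi_inv; apply: Kop_xcons.
- by move=> psi psi_inv; rewrite Kop_LopC.
Qed.

(* Transpose of [e^Q x_n = (x_n bullet) e^Q], as [x_n bullet = x_n + D_n]. *)
Lemma expQT_xcons n phi x : perm_inv phi ->
  expQT phi (xcons n x) =
  expQT (fun y => (coefb n y.1 + coefc n y.1) * phi y +
    (Lop (fun m _ => q m n + q n m) phi y + phi (xcons n y))) x.
Proof.
move=> phi_inv; rewrite /expQT.
set L2 := lexp (Lop coefb); set L3 := lexp (Lop coefc); set K := lexp (Kop q).
have L2_lin : grp_linear L2 by apply: lexp_grp_linear; apply: Lop_grp_linear.
have L3_lin : grp_linear L3 by apply: lexp_grp_linear; apply: Lop_grp_linear.
have K_lin : grp_linear K by apply: lexp_grp_linear; apply: Kop_grp_linear.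
have K_inv : perm_inv (K phi) by apply: lexp_preserves_inv => //; apply: perm_inv_Kop.
have L3_inv : perm_inv (L3 (K phi)).
  by apply: lexp_preserves_inv => //; apply: perm_inv_Lop.
(* The exponential of [Kop q] turns [x_n] into the part of [x_n + D_n] free of d/d alpha; the other
   two exponentials then add [coefc n] and [coefb n]. *)
pose psi y := Lop (fun m _ => q m n + q n m) phi y + phi (xcons n y).
have KE : K phi \o xcons n = K psi.
  rewrite (_ : psi = fun y => 1 * Lop (fun m _ => q m n + q n m) phi y + (phi \o xcons n) y).
    rewrite (K_lin (fun=> 1)); apply: funext => y.
    by rewrite mul1r; apply: lexp_Kop_xcons.
  by apply: funext => y; rewrite mul1r.
have L3E : L3 (K phi) \o xcons n = fun y => coefc n y.1 * L3 (K phi) y + L3 (K psi) y.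
  by apply: funext => y; rewrite -KE; apply: lexp_Lop_xcons.
rewrite (K_lin (fun al => coefb n al + coefc n al) phi psi).
rewrite (L3_lin (fun al => coefb n al + coefc n al)).
rewrite (L2_lin (fun al => coefb n al + coefc n al)).
by rewrite /L2 lexp_Lop_xcons // -/L2 L3E L2_lin addrA mulrDl.
Qed.

Hypotheses (r_bichar : bicharacter r)
  (r_a : forall i j, r (bgen i) (bgen j) = (cexp (a i j))%:A)
  (r_b : forall i n, r (bgen i) (bx k n) = b i n)
  (r_c : forall n i, r (bx k n) (bgen i) = c n i)
  (r_q : forall m n, r (bx k m) (bx k n) = q m n).

(** Each slot of [r] is a character of G when the other holds a grouplike, so [grp_exp] is applied
    to the first slot and then to the second. *)
Lemma bichar_gauss al : r (al, [::]) (al, [::]) = (gauss al)%:A.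
Proof.
have genE be j : r (be, [::]) (bgen j) = (cexp (\sum_i a i j * (be i)%:~R))%:A.
  apply: (grp_exp (f := fun be => r (be, [::]) (bgen j))) => [|x y|i].
  - by rewrite bichar_bone1.
  - exact: bichar_grpD1.
  - exact: r_a.
rewrite (grp_exp (f := fun be => r (al, [::]) (be, [::]))
    (z := fun j => \sum_i a i j * (al i)%:~R)) => [|||j].
- rewrite /gauss exchange_big; congr (cexp _)%:A; apply: eq_bigr => j _.
  rewrite mulr_suml; apply: eq_bigr => i _.
  by rewrite -mulrA -rmorphM.
- by rewrite bichar_bone2.
- by move=> x y; apply: bichar_grpD2.
- exact: genE.
Qed.

Lemma bichar_coefb al n : r (al, [::]) (bx k n) = coefb n al.
Proof.
apply: (grp_additive (f := fun al => r (al, [::]) (bx k n))) => [x y|i].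
  exact: bichar_grp_bx.
exact: r_b.
Qed.

Lemma bichar_coefc al n : r (bx k n) (al, [::]) = coefc n al.
Proof.
apply: (grp_additive (f := fun al => r (bx k n) (al, [::]))) => [x y|i].
  exact: bichar_bx_grp.
exact: r_c.
Qed.

(** The induction generalizes over [phi], because removing a head variable replaces [phi] by its
    transform under bullet-multiplication by [x_n]. *)
Lemma expQT_EQB phi x : perm_inv phi -> expQT phi x = ev phi (EQB r x).
Proof.
case: x => al mu; elim: mu phi => [|n mu IH] phi phi_inv.
  by rewrite /expQT !lexp_nil ev_EQB_grp ev_seq1 bichar_gauss.
rewrite -[(al, n :: mu)]/(xcons n (al, mu)) expQT_xcons // IH; last first.
  move=> be ka nu ka_nu /=; congr (_ * _ + (_ + _)); first exact: phi_inv.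
    exact: perm_inv_Lop.
  by apply: phi_inv; rewrite perm_cons.
rewrite -bmul_bx ev_EQB_bmul // ev_ext2 ev_EQB_bx //; apply: eq_ev => y.
rewrite ev_bulletB_bx // bichar_coefb bichar_coefc; congr (_ + (_ + _)).
by congr (Lop _ _ _); apply: funext => m; rewrite !r_q.
Qed.

Lemma expQ_EQ X : fs_equiv (expQ a b c q X) (EQ r X).
Proof.
move=> phi phi_inv; rewrite transposes_expQ ev_EQ.
by apply: eq_ev => x; apply: expQT_EQB.
Qed.

End ExpQ.

Theorem theorem4p7 (R : realType) (k : nat) (A : comAlgType R[i])
  (r : basis k -> basis k -> A)
  (a : 'I_k -> 'I_k -> R[i]) (b : 'I_k -> nat -> A)
  (c : nat -> 'I_k -> A) (q : nat -> nat -> A) :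
  bicharacter r ->
  (forall al be : grp k, exists z : R[i], r (al, [::]) (be, [::]) = z%:A) ->
  (forall i j : 'I_k, r (bgen i) (bgen j) = (cexp (a i j))%:A) ->
  (forall (i : 'I_k) (n : nat), r (bgen i) (bx k n) = b i n) ->
  (forall (n : nat) (i : 'I_k), r (bx k n) (bgen i) = c n i) ->
  (forall m n : nat, r (bx k m) (bx k n) = q m n) ->
  (forall X : fsum k R[i],
      fs_eq (expQ a b c q (emb A X)) (EQ r (emb A X)) /\
      fs_eq (expQ a b c q (emb A X)) (dot r (emb A X))) /\
  (forall X Y : fsum k A,
      fs_eq (expQ a b c q (fmul X Y)) (bullet (symz r) (expQ a b c q X) (expQ a b c q Y))) /\
  fs_eq (expQ a b c q (fone k A)) (fone k A) /\
  (forall X Y : fsum k A,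
      fs_eq (expQ a b c q (X ++ Y)) (expQ a b c q X ++ expQ a b c q Y)) /\
  (forall (x : A) (X : fsum k A),
      fs_eq (expQ a b c q (scl x X)) (scl x (expQ a b c q X))).
Proof.
move=> r_bichar _ r_a r_b r_c r_q.
have EQE X : fs_equiv (expQ a b c q X) (EQ r X) by apply: expQ_EQ.
split=> [X|]; first split; first exact/fs_equivW.
  by apply: fs_equivW => phi phi_inv; rewrite EQE // ev_dot.
split=> [X Y|]; last split; last split.
(* Multiplicativity is known for [EQ]; [bullet_equiv] transports it to both arguments. *)
- apply: fs_equivW => phi phi_inv; rewrite EQE // ev_EQ_fmul //.
  by apply: (bullet_equiv r_bichar) => // psi psi_inv; rewrite EQE.
- apply: fs_equivW => phi phi_inv; rewrite EQE // ev_EQ ev_seq1 ev_EQB_grp.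
  by rewrite !ev_seq1 bichar_bone1 // mul1r.
(* Having a transpose already forces linearity. *)
- by move=> X Y; apply: fs_equivW => phi _; rewrite ev_cat !transposes_expQ ev_cat.
- by move=> x X; apply: fs_equivW => phi _; rewrite ev_scl !transposes_expQ ev_scl.
Qed.
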